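(* Let $G$ be a finite solvable group and let $p$ be a prime. Then there exists a finite group $H$ of $p$-central type such that $G$ is isomorphic to a subgroup of $H/\mathrm{Z}(H)$.
   Context: $\mathrm{Z}(H)$ denotes the center of $H$. For a finite group $X$, $\mathrm{IBr}(X)$ denotes the set of irreducible $p$-Brauer characters of $X$. A Brauer character $\lambda\in\mathrm{IBr}(\mathrm{Z}(H))$ is called fully ramified (in $H$) if the induced Brauer character satisfies $\lambda^H=e\varphi$ for some integer $e$ and some $\varphi\in\mathrm{IBr}(H)$. A finite $p$-solvable group $H$ is said to be of $p$-central type if there exists a fully ramified $\lambda\in\mathrm{IBr}(\mathrm{Z}(H))$; for $p$-solvable $H$ this is equivalent to the existence of some $\varphi\in\mathrm{IBr}(H)$ with $\varphi(1)^2=|H:\mathrm{Z}(H)|_{p'}$, where $n_{p'}$ denotes the $p'$-part of the integer $n$. *)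

(* Defs.v *)
From HB Require Import structures.
From mathcomp Require Import all_boot all_order all_algebra.
From mathcomp Require Import all_fingroup all_solvable all_field all_character.

Set Implicit Arguments.
Unset Strict Implicit.
Unset Printing Implicit Defensive.

Import GroupScope GRing.Theory.
Local Open Scope ring_scope.

(* Brauer characters depend on the choice of a maximal ideal M, containing p, *)
(* of the ring Aint of algebraic integers.  Giving M together with the field  *)
(* F = Aint / M (algebraically closed, of characteristic p) is the same as    *)
(* giving a surjective ring morphism Aint -> F; it is encoded here as a total *)
(* function on algC, whose values outside Aint are irrelevant.                *)
Record is_reduction (p : nat) (F : closedFieldType) (red : algC -> F) : Prop :=
  IsReduction {
    reduction_char : p \in [pchar F];
    reduction1 : red 1 = 1;
    reductionB : {in Aint &, {morph red : x y / x - y}};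
    reductionM : {in Aint &, {morph red : x y / x * y}};
    reduction_surj : forall a, exists2 x, x \in Aint & red x = a
  }.

Section Brauer.

Variables (p : nat) (F : closedFieldType) (red : algC -> F).
Variables (gT : finGroupType) (G : {group gT}).

Definition p_regular : {set gT} := [set x in G | p^'.-elt x].

(* The multiset s consists of the roots of unity of p'-order lifting the      *)
(* eigenvalues, with multiplicity, of rG x; such a lift is unique.  Brauer    *)
(* characters, which are functions on the p-regular elements of G, are        *)
(* represented by class functions on G that vanish on all other elements.     *)
Definition affords_Brauer n (rG : mx_representation F G n) (phi : 'CF(G)) :=
  phi \in 'CF(G, p_regular) /\
  {in p_regular, forall x, exists s : seq algC,
    [/\ {in s, forall z, exists2 m, p^'.-nat m & m.-unity_root z},
        char_poly (rG x) = \prod_(z <- s) ('X - (red z)%:P)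
      & phi x = \sum_(z <- s) z]}.

Definition IBr (phi : 'CF(G)) : Prop :=
  exists n (rG : mx_representation F G n),
    mx_irreducible rG /\ affords_Brauer rG phi.

End Brauer.

(* The formula |K|^-1 \sum_(y in G) lam (x ^ y), with lam extended by 0, that *)
(* defines 'Ind also defines induction of Brauer characters: when lam         *)
(* vanishes off the p-regular elements of K, 'Ind lam vanishes off those of G.*)
Definition fully_ramified (p : nat) (F : closedFieldType) (red : algC -> F)
    (gT : finGroupType) (H : {group gT}) (lam : 'CF('Z(H))) : Prop :=
  exists (e : int) (phi : 'CF(H)),
    IBr p red phi /\ 'Ind[H, 'Z(H)] lam = e%:~R *: phi.

Definition p_solvable (p : nat) (gT : finGroupType) (G : {group gT}) : Prop :=
  exists s : seq {group gT},
    [/\ all (fun N : {group gT} => N <| G) s,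
        path (fun A B : {group gT} =>
          (A \subset B) && (p.-group (B / A)%g || p^'.-group (B / A)%g)) 1%G s
      & last 1%G s = G].

Definition p_central_type (p : nat) (F : closedFieldType) (red : algC -> F)
    (gT : finGroupType) (H : {group gT}) : Prop :=
  p_solvable p H /\
  exists lam : 'CF('Z(H)), IBr p red lam /\ fully_ramified p red lam.

(* Main.v *)
Require Import Defs.
From HB Require Import structures.
From mathcomp Require Import all_boot all_order all_algebra.
From mathcomp Require Import all_fingroup all_solvable all_field all_character.
From mathcomp Require Import mxtens ring.

Set Implicit Arguments.
Unset Strict Implicit.
Unset Printing Implicit Defensive.

Import GroupScope.

(* Induct on |G|: if N = (F_q)^k is a normal subgroup of G and G / N embeds   *)
(* in Q = H / Z(H), then G embeds in the semidirect product of M = (F_q)^k[Q] *)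
(* by Q (Kaloujnine-Krasner).  Let E be the Heisenberg group on M + M^*, with *)
(* center of order q.  As Q preserves M, M^* and their pairing, H acts on E   *)
(* through Q; the new group H' = E : H has center Z(E) x Z(H), and            *)
(* H' / Z(H') is the semidirect product of M + M^* by Q.                      *)
(*   Full ramification is carried through the induction by an absolutely      *)
(* irreducible representation rho of H whose degree divides |H : Z(H)|, such  *)
(* that every noncentral p-regular x has a commutator z = [x, g] in Z(H) with *)
(* rho(z) != 1.  Then rho(x) is conjugate to a nontrivial scalar multiple of  *)
(* itself, so the Brauer character of rho vanishes off Z(H), and the one      *)
(* induced from Z(H) is |H : Z(H)| / deg rho times it.  For q = p rho is      *)
(* inflated to H'; for q != p it is tensored with the Schrodinger             *)
(* representation of E, which extends to H' since Q preserves M and M^*.      *)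
(* The commutator condition for H' rests on duality: for (v, h) in H', either *)
(* v is orthogonal to the fixed points of h and then (v, h) is conjugate to h *)
(* modulo Z(E), or a fixed point of h has a nontrivial commutator with it in  *)
(* Z(E); the latter is impossible for q = p and (v, h) p-regular.             *)

Import GRing.Theory.
Local Open Scope ring_scope.

(** Adjoining the dual of M along with M puts the two in perfect commutator duality, so the
    Heisenberg layer adds only ['F_q] to the center and a single representation can control every
    noncentral p-regular element. The induction [solvable_twisted_embedding] runs on [twisted_pair],
    a condition on one representation over [F] that mentions no Brauer character;
    [twisted_pair_central_type] converts it to full ramification once, at the end. The inductive
    step [twisted_embedding_ext] takes its embedding from [kaloujnine_krasner] and its new pair from
    [twisted_pair_inflate] (q = p) or [twisted_pair_schrodinger] (q != p). Both check commutators
    through the dichotomy [heis_conj_or_comm]. *)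

(** * Reduction of roots of unity modulo the maximal ideal *)

Section Reduction.

Variables (p : nat) (F : closedFieldType) (red : algC -> F).
Hypothesis red_p : is_reduction p red.

Lemma reduction0 : red 0 = 0.
Proof.
by have:= reductionB red_p (Aint1) (Aint1); rewrite !subrr.
Qed.

Lemma reductionD : {in Aint &, {morph red : x y / x + y}}.
Proof.
move=> x y Ax Ay; rewrite -[y in LHS]opprK (reductionB red_p) ?rpredN //.
by rewrite -[- y]sub0r (reductionB red_p) ?rpred0 // reduction0 sub0r opprK.
Qed.

Lemma reductionX x n : x \in Aint -> red (x ^+ n) = red x ^+ n.
Proof.
move=> Ax; elim: n => [|n IHn]; first by rewrite (reduction1 red_p).
by rewrite !exprS (reductionM red_p) ?rpredX // IHn.
Qed.

Lemma reduction_sum n (f : nat -> algC) :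
    (forall i, f i \in Aint) ->
  red (\sum_(i < n) f i) = \sum_(i < n) red (f i).
Proof.
move=> Af; elim: n => [|n IHn]; first by rewrite !big_ord0 reduction0.
by rewrite !big_ord_recr reductionD ?IHn //= rpred_sum.
Qed.

Lemma natr_pred_neq0 m : prime p -> p^'.-nat m -> m%:R != 0 :> F.
Proof.
move=> p_pr p'm; rewrite -(dvdn_pcharf (reduction_char red_p)).
by rewrite -prime_coprime // coprime_sym; apply: (p'nat_coprime p'm); rewrite pnat_id.
Qed.

(** If [x != 1], the geometric sum of the [x ^+ i] for [i < m] is 0; when [red x = 1] it reduces to
    [m] in [F], which is nonzero since [m] is prime to [p]. *)
Lemma reduction_unity_inj1 m x :
  prime p -> p^'.-nat m -> x ^+ m = 1 -> red x = 1 -> x = 1.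
Proof.
move=> p_pr p'm xm1 rx1; have m_gt0: (0 < m)%N by case/andP: p'm.
have Ax: x \in Aint by apply: (Aint_unity_root m_gt0); apply/unity_rootP.
apply/eqP; rewrite -subr_eq0; apply/negPn/negP=> x1_neq0.
have s0: \sum_(i < m) x ^+ i = 0.
  by apply: (mulfI x1_neq0); rewrite -subrX1 xm1 subrr mulr0.
case/eqP: (natr_pred_neq0 p_pr p'm).
rewrite -reduction0 -s0 reduction_sum => [|i]; last by rewrite rpredX.
rewrite -[m in LHS]card_ord -sumr_const.
by apply: eq_bigr => i _; rewrite reductionX // rx1 expr1n.
Qed.

Lemma reduction_prim_root m z : prime p -> p^'.-nat m ->
  m.-primitive_root z -> m.-primitive_root (red z).
Proof.
move=> p_pr p'm prz; have m_gt0: (0 < m)%N by case/andP: p'm.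
have Az: z \in Aint by apply: Aint_prim_root prz.
have rzm: red z ^+ m = 1.
  by rewrite -reductionX // (prim_expr_order prz) (reduction1 red_p).
have [d prd /dvdnP[e def_m]] := prim_order_exists m_gt0 rzm.
suffices: (m %| d)%N.
  by move=> m_d; rewrite (_ : m = d) //; apply/eqP; rewrite eqn_dvd m_d def_m dvdn_mull.
rewrite (prim_order_dvd prz); apply/eqP.
apply: (reduction_unity_inj1 p_pr p'm).
  by rewrite -exprM mulnC exprM (prim_expr_order prz) expr1n.
by rewrite reductionX // (prim_expr_order prd).
Qed.

End Reduction.

(** * Lifting roots of unity of p'-order from [F] to [algC] *)

Section Lift.

Variables (p : nat) (F : closedFieldType) (red : algC -> F).
Hypotheses (red_p : is_reduction p red) (p_pr : prime p).
Variable m : nat.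
Hypothesis p'm : p^'.-nat m.

Let m_gt0 : (0 < m)%N. Proof. by case/andP: p'm. Qed.

Definition prim_root_algC : algC := sval (C_prim_root_exists m_gt0).
Local Notation zeta := prim_root_algC.

Let prz : m.-primitive_root zeta. Proof. by rewrite /zeta; case: C_prim_root_exists. Qed.

(** The powers of [red zeta] are exactly the [m]-th roots of unity of [F], so the default 0 is
    reached only outside them. *)
Definition unity_lift (a : F) : algC :=
  if [pick i : 'I_m | red zeta ^+ i == a] is Some i then zeta ^+ i else 0.

Lemma unity_liftP a : a ^+ m = 1 -> unity_lift a ^+ m = 1 /\ red (unity_lift a) = a.
Proof.
move=> am1; rewrite /unity_lift; case: pickP => [i /eqP <- | noi].
  rewrite -exprM mulnC exprM (prim_expr_order prz) expr1n; split=> //.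
  by rewrite (reductionX red_p) // (Aint_prim_root prz).
have [i def_a] := prim_rootP (reduction_prim_root red_p p_pr p'm prz) am1.
by have:= noi i; rewrite def_a eqxx.
Qed.

Lemma unity_lift_red x : x ^+ m = 1 -> unity_lift (red x) = x.
Proof.
move=> xm1.
have Aunit y : y ^+ m = 1 -> y \in Aint.
  by move=> ym1; apply: (Aint_unity_root m_gt0); apply/unity_rootP.
have rm1: red x ^+ m = 1 by rewrite -(reductionX red_p) ?Aunit // xm1 (reduction1 red_p).
have [lm1 rl] := unity_liftP rm1.
set y := unity_lift _ in lm1 rl *.
have yv : y * y ^+ m.-1 = 1 by rewrite -exprS prednK.
(* [x] and its candidate [y] have the same reduction, so their quotient, written with [y ^+ m.-1] as
   the inverse of [y], reduces to 1. *)
have: x * y ^+ m.-1 = 1.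
  apply: (reduction_unity_inj1 red_p p_pr p'm).
    by rewrite exprMn xm1 -exprM mulnC exprM lm1 expr1n mulr1.
  rewrite (reductionM red_p) ?rpredX ?Aunit // (reductionX red_p) ?Aunit //.
  by rewrite rl -exprS prednK.
move=> xyv; have y0 : y != 0.
  by apply: contraTneq (oner_neq0 algC) => y0; rewrite -lm1 y0 expr0n gtn_eqF ?eqxx.
apply: (mulIf (x := y ^+ m.-1)); first by rewrite expf_neq0.
by rewrite xyv.
Qed.

Lemma unity_liftM a b : a ^+ m = 1 -> b ^+ m = 1 ->
  unity_lift (a * b) = unity_lift a * unity_lift b.
Proof.
move=> am1 bm1; have [lam la] := unity_liftP am1; have [lbm lb] := unity_liftP bm1.
rewrite -{1}la -{1}lb -(reductionM red_p) ?unity_lift_red ?exprMn ?lam ?lbm ?mulr1 //.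
  by apply: (Aint_unity_root m_gt0); apply/unity_rootP.
by apply: (Aint_unity_root m_gt0); apply/unity_rootP.
Qed.

(** The Brauer character value as a function of the characteristic polynomial alone, which makes
    invariance under conjugation immediate. *)
Definition lift_trace (P : {poly F}) : algC :=
  \sum_(a <- sval (closed_field_poly_normal P)) unity_lift a.

Lemma lift_traceE r :
  lift_trace (\prod_(a <- r) ('X - a%:P)) = \sum_(a <- r) unity_lift a.
Proof.
rewrite /lift_trace; case: closed_field_poly_normal => s /= Ds.
apply/perm_big/prod_XsubC_eq; rewrite lead_coef_prod_XsubC scale1r in Ds.
by rewrite Ds.
Qed.

End Lift.

(** * Characteristic polynomials and the Brauer character of a representation *)

Lemma char_poly_conj (R : comNzRingType) n (A B C : 'M[R]_n) :
  B *m C = 1%:M -> char_poly (B *m A *m C) = char_poly A.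
Proof.
move=> BC1; rewrite /char_poly.
have BC : map_mx polyC B *m map_mx polyC C = 1%:M by rewrite -map_mxM BC1 map_mx1.
have ->: char_poly_mx (B *m A *m C) =
   map_mx polyC B *m char_poly_mx A *m map_mx polyC C.
  rewrite /char_poly_mx mulmxBr mulmxBl !map_mxM; congr (_ - _).
  by rewrite scalar_mxC -mulmxA BC mulmx1.
by rewrite !det_mulmx mulrAC -det_mulmx BC det1 mul1r.
Qed.

Lemma char_poly_scale (R : fieldType) n (A : 'M[R]_n) (c : R) r : c != 0 ->
    char_poly A = \prod_(a <- r) ('X - a%:P) ->
  char_poly (c *: A) = \prod_(a <- r) ('X - (c * a)%:P).
Proof.
move=> c0 chA.
have sz_r: size r = n.
  by apply/eqP; rewrite -eqSS -(size_prod_XsubC r id) -chA size_char_poly.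
(* Each entry of ['X - c A] is [c] times the matching entry of [c^-1 'X - A]. *)
have ->: char_poly (c *: A) = c ^+ n *: (char_poly A \Po (c^-1 *: 'X)).
  rewrite /char_poly -det_map_mx -mul_polyC.
  rewrite rmorphXn -detZ; congr (\det _); apply/matrixP=> i j.
  rewrite !mxE /= -[LHS]/('X *+ (i == j) - (c * A i j)%:P) comp_polyB comp_polyC.
  rewrite mulrBr raddfMn /= comp_polyX -polyCM.
  by rewrite mulrnAr -mul_polyC mulrA -!polyCM mulfV // mul1r.
rewrite chA rmorph_prod /= -sz_r.
elim: r {chA sz_r} => [|a r IHr]; first by rewrite !big_nil scale1r.
rewrite !big_cons -IHr /= exprS -!mul_polyC polyCM comp_polyB comp_polyX comp_polyC.
rewrite mulrACA; congr (_ * _).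
by rewrite mulrBr mulrA -!polyCM mulfV // mul1r.
Qed.

Section BrauerCharacter.

Variables (p : nat) (F : closedFieldType) (red : algC -> F).
Hypotheses (red_p : is_reduction p red) (p_pr : prime p).
Variable m : nat.
Hypothesis p'm : p^'.-nat m.
Variables (gT : finGroupType) (G : {group gT}) (n : nat).
Variable rG : mx_representation F G n.
Hypothesis dvd_m : {in p_regular p G, forall x, x ^+ m = 1}%g.

Local Notation trace := (lift_trace red p'm).

Lemma p_regularJ x y : y \in G -> (x ^ y \in p_regular p G)%g = (x \in p_regular p G).
Proof. by move=> Gy; rewrite !inE groupJr // p_eltJ. Qed.

Fact brauer_char_subproof :
  is_class_fun <<G>>%g [ffun x => trace (char_poly (rG x)) *+ (x \in p_regular p G)].
Proof.
rewrite genGid; apply: intro_class_fun => [x y Gx Gy | x nGx]; last first.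
  by rewrite inE (negPf nGx).
rewrite p_regularJ // conjgE !repr_mxM ?groupM ?groupV //.
by rewrite mulmxA char_poly_conj // -repr_mxM ?groupV // mulVg repr_mx1.
Qed.
Definition brauer_char : 'CF(G) := Cfun 0 brauer_char_subproof.

Lemma brauer_charE x : x \in p_regular p G -> brauer_char x = trace (char_poly (rG x)).
Proof. by move=> Gx; rewrite cfunE Gx. Qed.

Lemma brauer_char_off x : x \notin p_regular p G -> brauer_char x = 0.
Proof. by move=> Gx; rewrite cfunE (negPf Gx). Qed.

(** On an eigenvector for [a], the matrix of [x ^+ m = 1] acts as [a ^+ m]. *)
Lemma char_poly_split x : x \in p_regular p G ->
  exists2 r, char_poly (rG x) = \prod_(a <- r) ('X - a%:P) & {in r, forall a, a ^+ m = 1}.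
Proof.
move=> Gx; have [r] := closed_field_poly_normal (char_poly (rG x)).
rewrite (monicP (char_poly_monic _)) scale1r => ch_x; exists r => // a r_a.
have: eigenvalue (rG x) a by rewrite eigenvalue_root_char ch_x root_prod_XsubC.
case/eigenvalueP=> v v_a v0.
have vX k : v *m rG (x ^+ k)%g = a ^+ k *: v.
  elim: k => [|k IHk]; first by rewrite repr_mx1 mulmx1 scale1r.
  have Gx1: x \in G by case/setIdP: Gx.
  by rewrite expgSr repr_mxM ?groupX // mulmxA IHk -scalemxAl v_a scalerA -exprSr.
have:= vX m; rewrite dvd_m // repr_mx1 mulmx1 => /eqP.
by rewrite -subr_eq0 -{1}[v]scale1r -scalerBl scaler_eq0 (negPf v0) orbF subr_eq0 => /eqP.
Qed.

Lemma brauer_char_afforded : affords_Brauer p red rG brauer_char.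
Proof.
split=> [|x Gx]; first by apply/cfun_onP=> x /brauer_char_off.
have [r ch_x r_m] := char_poly_split Gx.
exists [seq unity_lift red p'm a | a <- r]; split.
- move=> _ /mapP[a r_a ->]; exists m => //.
  by apply/unity_rootP; case: (unity_liftP red_p p_pr p'm (r_m a r_a)).
- rewrite ch_x big_map big_seq [RHS]big_seq; apply: eq_bigr => a r_a.
  by case: (unity_liftP red_p p_pr p'm (r_m a r_a)) => _ ->.
by rewrite brauer_charE // ch_x lift_traceE big_map.
Qed.

(* Multiplying the eigenvalues of rG x by c permutes them. *)
Lemma brauer_char_eq0 x y c : x \in p_regular p G -> y \in G ->
  c ^+ m = 1 -> c != 1 -> rG (x ^ y)%g = c *: rG x -> brauer_char x = 0.
Proof.
move=> Gx Gy cm1 c1 rGxy; have [r ch_x r_m] := char_poly_split Gx.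
have c0: c != 0.
  apply: contraTneq (oner_neq0 F) => c0; rewrite -cm1 c0 expr0n gtn_eqF ?eqxx //.
  by case/andP: p'm.
have: brauer_char x = brauer_char (x ^ y)%g by rewrite cfunJ.
rewrite !brauer_charE ?p_regularJ // rGxy (char_poly_scale c0 ch_x) ch_x.
rewrite -(big_map (fun a => c * a) xpredT (fun a => 'X - a%:P)) !lift_traceE big_map.
rewrite big_seq [RHS]big_seq.
rewrite [RHS](eq_bigr (fun a => unity_lift red p'm c * unity_lift red p'm a)); last first.
  by move=> a r_a; rewrite (unity_liftM red_p p_pr p'm cm1 (r_m a r_a)).
rewrite -big_seq -mulr_sumr -big_seq => /eqP.
(* Here [S] equals the lift of [c] times [S]; if [S] were nonzero, the lift of [c], and hence [c],
   would be 1. *)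
set S := \sum_(a <- r) _; rewrite -subr_eq0 -{1}[S]mul1r -mulrBl mulf_eq0.
case/orP=> [|/eqP-> //]; rewrite subr_eq0 => /eqP lc1.
have [_ rlc] := unity_liftP red_p p_pr p'm cm1.
by case/eqP: c1; rewrite -rlc -lc1 (reduction1 red_p).
Qed.

Lemma brauer_char_scalar x a : x \in p_regular p G -> rG x = a%:M ->
  brauer_char x = n%:R * unity_lift red p'm a.
Proof.
move=> Gx rGx; rewrite brauer_charE //.
have ->: char_poly (rG x) = \prod_(b <- nseq n a) ('X - b%:P).
  rewrite rGx char_poly_trig ?scalar_mx_is_trig //.
  rewrite big_nseq -[RHS]big_const_ord.
  by apply: eq_bigr => i _; rewrite mxE eqxx.
by rewrite lift_traceE big_nseq iter_addr_0 mulr_natl.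
Qed.

End BrauerCharacter.

(** * From twisted pairs to p-central type *)

(** Chief factors of a solvable group are elementary abelian, hence p-groups or p'-groups. *)
Lemma solvable_p_solvable (p : nat) (gT : finGroupType) (G : {group gT}) :
  solvable G -> p_solvable p G.
Proof.
move=> solG; have [s chief_s last_s] := chief_series_exists (normal_refl G).
exists s; split=> //.
  elim: s (1%G) chief_s {last_s} => //= A s IHs B /andP[/andP[_ ->]].
  exact: IHs.
elim: s (1%G) chief_s {last_s} => //= A s IHs B /andP[chAB /IHs->].
have /andP[/maxgroupp/andP[/andP[sBA _] _] _] := chAB.
have [|_ _ abAB] := minnormal_solvable (chief_factor_minnormal chAB) _ (quotient_sol _ solG).
  by case/andP: chAB => _ /andP[sAG _]; apply: quotientS.
have [q _ /abelem_pgroup qAB] := is_abelemP abAB.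
rewrite andbT sBA /=; have [<- | q_p] := eqVneq q p; first by rewrite qAB.
by rewrite (_ : p^'.-group (A / B)%g) ?orbT //; apply: pi_pgroup qAB _; rewrite !inE.
Qed.

(** The commutator condition is restricted to p-regular [x] because Brauer characters see nothing
    else; this leaves room for representations that are trivial on central p-elements. *)
Definition twisted_pair (p : nat) (F : closedFieldType) (gT : finGroupType) n
    (rG : mx_representation F [set: gT] n) :=
  [/\ solvable [set: gT], mx_absolutely_irreducible rG,
      (n %| #|[set: gT] : 'Z([set: gT])|)%N
    & forall x, p^'.-elt x -> x \notin 'Z([set: gT]) ->
      exists2 g, [~ x, g] \in 'Z([set: gT]) & rG [~ x, g] != 1%:M].

Lemma twisted_pair_central_type (p : nat) (F : closedFieldType) (red : algC -> F)
    (gT : finGroupType) n (rG : mx_representation F [set: gT] n) :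
  is_reduction p red -> prime p -> twisted_pair p rG -> p_central_type p red [set: gT].
Proof.
move=> red_p p_pr [solG irrG n_dvd central]; split; first exact: solvable_p_solvable.
set G := [set: gT]%G in rG irrG n_dvd central *; set Z := 'Z(G) in n_dvd central *.
have n_gt0: (0 < n)%N by case/andP: irrG.
have Gx x : x \in G by rewrite inE.
(* This exponent kills the p-regular elements of both [G] and its center, so [lam] and [phi] are
   built from the same lift. *)
pose m := (#|G|`_p^')%N; have p'm: p^'.-nat m by apply: part_pnat.
have p_reg_m : {in p_regular p G, forall x, x ^+ m = 1}%g.
  move=> x /setIdP[_ p'x]; apply/eqP; rewrite -order_dvdn.
  by rewrite -(part_pnat_id p'x) partn_dvd // order_dvdG.
have p_reg_mZ : {in p_regular p 'Z(G)%G, forall x, x ^+ m = 1}%g.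
  by move=> x /setIdP[_ p'x]; apply: p_reg_m; rewrite inE p'x Gx.
(* By Schur's lemma the center acts by scalars; the resulting central character [c] affords
   [lam]. *)
have scalZ z : z \in Z -> exists a, rG z = a%:M.
  case/centerP=> _ cz; apply/is_scalar_mxP; apply: (mx_abs_irr_cent_scalar irrG).
  by apply/centgmxP=> y _; rewrite -!repr_mxM // cz.
pose i0 := Ordinal n_gt0; pose c z := rG z i0 i0.
have rGZ z : z \in Z -> rG z = (c z)%:M.
  by case/scalZ=> a def_z; rewrite def_z /c def_z mxE eqxx.
have c_repr : mx_repr 'Z(G)%G (fun z => (c z)%:M : 'M_1).
  split=> [|x y Zx Zy]; first by rewrite /c repr_mx1 mxE eqxx.
  rewrite -scalar_mxM; congr (_%:M); rewrite {1}/c repr_mxM // (rGZ x) // (rGZ y) //.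
  by rewrite -scalar_mxM mxE eqxx.
pose rZ := MxRepresentation c_repr.
pose lam := brauer_char red p'm rZ; pose phi := brauer_char red p'm rG.
have [e def_e] := dvdnP n_dvd.
exists lam; split.
  exists 1%N, rZ; split; last exact: brauer_char_afforded.
  exact/mx_abs_irrW/linear_mx_abs_irr.
exists e, phi; split.
  by exists n, rG; split; [exact: mx_abs_irrW | exact: brauer_char_afforded].
have sZG : Z \subset G by apply: subsetT.
apply/cfun_inP=> x _; rewrite cfIndE // [RHS]cfunE.
have [Zx | nZx] := boolP (x \in Z); last first.
  rewrite big1 ?mulr0 => [|y _]; last first.
    rewrite cfun0 // -mem_conjgV (normsP (char_norm (center_char G))) //.
  have [p'x | p_x] := boolP (x \in p_regular p G); last first.
    by rewrite brauer_char_off ?mulr0.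
  have [g Zxg rxg] := central x (setIdP p'x).2 nZx.
  have rGxg : rG (x ^ g)%g = c [~ x, g]%g *: rG x.
    by rewrite -[(x ^ g)%g](mulKVg x) -/(commg x g) repr_mxM // (rGZ _ Zxg) mul_mx_scalar.
  have c1 : c [~ x, g]%g != 1 by apply: contraNneq rxg => c1; rewrite rGZ // c1.
  have cX k : rG ([~ x, g] ^+ k)%g = (c [~ x, g]%g ^+ k)%:M.
    elim: k => [|k IHk]; first by rewrite repr_mx1.
    by rewrite expgS exprS repr_mxM // IHk (rGZ _ Zxg) -scalar_mxM.
  (* Since the commutator is central, the [m]-th power of [x ^ g] is that of [x] times that of the
     commutator, and the first two are trivial. *)
  have xg_m : ([~ x, g] ^+ m = 1)%g.
    have := p_reg_m (x ^ g)%g; rewrite p_regularJ // => /(_ p'x).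
    rewrite -[(x ^ g)%g](mulKVg x) -/(commg x g) expgMn ?(p_reg_m x) ?mul1g //.
    by case/centerP: Zxg => _ cz; symmetry; apply: cz.
  have cm1 : c [~ x, g]%g ^+ m = 1.
    by have /matrixP/(_ i0 i0) := cX m; rewrite xg_m repr_mx1 !mxE eqxx !mulr1n => <-.
  by rewrite (brauer_char_eq0 red_p p_pr p'm p_reg_m p'x (Gx g) cm1 c1 rGxg) mulr0.
rewrite (eq_bigr (fun=> lam x)) => [|y _]; last first.
  by case/centerP: Zx => _ cz; rewrite conjgE (cz y) ?mulKg.
rewrite sumr_const -[lam x *+ _]mulr_natl mulrA [_ * #|_|%:R]mulrC -Num.Theory.natf_indexg //.
have [p'x | p_x] := boolP (x \in p_regular p G); last first.
  rewrite [phi x]brauer_char_off // [lam x]brauer_char_off ?mulr0 //.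
  by apply: contra p_x => /setIdP[_ p'x]; rewrite inE Gx.
rewrite [phi x](brauer_char_scalar _ _ p'x (rGZ x Zx)).
rewrite [lam x](@brauer_char_scalar _ _ _ _ _ _ _ _ _ _ (c x)) //; last first.
  by case/setIdP: p'x => _ p'x; apply/setIdP.
by rewrite mul1r mulrA -pmulrn -natrM -def_e.
Qed.

(** * Duality for the trace pairing *)

Lemma mxtrace_nondeg (F : fieldType) m n (A : 'M[F]_(m, n)) :
  (forall B : 'M_(n, m), \tr (A *m B) = 0) -> A = 0.
Proof.
move=> trA0; apply/matrixP=> i j; rewrite mxE -(trA0 (delta_mx j i)).
rewrite /mxtrace (bigD1 i) //= big1 => [|l l_i]; last first.
  by rewrite mxE big1 // => s _; rewrite !mxE (negPf l_i) andbF mulr0.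
rewrite addr0 mxE (bigD1 j) //= big1 => [|s s_j]; last by rewrite mxE (negPf s_j) mulr0.
by rewrite mxE !eqxx mulr1 addr0.
Qed.

(** Double annihilator: testing against multiples of [cokermx C] shows that the rows of [A] lie in
    the row space of [C]. *)
Lemma trace_coker (F : fieldType) k m (A : 'M[F]_(k, m)) (C : 'M[F]_m) :
    (forall B : 'M_(m, k), C *m B = 0 -> \tr (A *m B) = 0) ->
  exists A0, A = A0 *m C.
Proof.
move=> tr0; apply/submxP; rewrite submxE; apply/eqP/mxtrace_nondeg=> B.
by rewrite -mulmxA; apply: tr0; rewrite mulmxA mulmx_coker mul0mx.
Qed.

Lemma trace_ker (F : fieldType) k m (A : 'M[F]_(m, k)) (C : 'M[F]_m) :
    (forall B : 'M_(k, m), B *m C = 0 -> \tr (B *m A) = 0) ->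
  exists A0, A = C *m A0.
Proof.
move=> tr0; have [|A0 def_A] := @trace_coker _ _ _ A^T C^T.
  move=> B CB0; rewrite -[B]trmxK -trmx_mul mxtrace_tr; apply: tr0.
  by apply: trmx_inj; rewrite trmx_mul trmxK CB0 trmx0.
by exists A0^T; apply: trmx_inj; rewrite trmx_mul trmxK.
Qed.

(** * The Heisenberg group extended by a top group *)

Section Heisenberg.

Variables (q k m : nat) (hT : finGroupType).
Variable R : mx_representation 'F_q [set: hT] m.

(** Recording [R] in the type lets the group law, which depends on [R], be attached as a canonical
    instance. *)
Definition heisenberg (_ : mx_representation 'F_q [set: hT] m) : Type :=
  'M['F_q]_(k, m) * 'M['F_q]_(m, k) * 'F_q * hT.
HB.instance Definition _ := Finite.on (heisenberg R).

Definition heis (a : 'M['F_q]_(k, m)) (b : 'M['F_q]_(m, k)) (z : 'F_q) (h : hT) :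
    heisenberg R :=
  (a, b, z, h).

(* The product of the block matrices [1 a z; 0 (R h) b; 0 0 1], except that   *)
(* the corner entry is the trace of a product rather than the product.        *)
Definition heis_mul (x y : heisenberg R) : heisenberg R :=
  let: (a, b, z, h) := x in let: (a', b', z', h') := y in
  heis (a *m R h' + a') (b + R h *m b') (z + z' + \tr (a *m b')) (h * h')%g.

Definition heis_inv (x : heisenberg R) : heisenberg R :=
  let: (a, b, z, h) := x in
  heis (- (a *m R h^-1%g)) (- (R h^-1%g *m b)) (\tr (a *m R h^-1%g *m b) - z) h^-1%g.

Fact heis_mulA : associative heis_mul.
Proof.
move=> [[[a b] z] h] [[[a' b'] z'] h'] [[[a'' b''] z''] h''].
rewrite /heis_mul /heis /= !repr_mxM ?inE // mulgA.
congr (_, _, _, _); rewrite ?mulmxDl ?mulmxDr ?mulmxA ?addrA //.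
rewrite !mxtraceD; ring.
Qed.

Fact heis_mul1 : left_id (heis 0 0 0 1%g) heis_mul.
Proof.
move=> [[[a b] z] h].
by rewrite /heis_mul /heis /= !mul0mx repr_mx1 mul1mx mxtrace0 !add0r addr0 mul1g.
Qed.

Fact heis_mulV : left_inverse (heis 0 0 0 1%g) heis_inv heis_mul.
Proof.
move=> [[[a b] z] h]; rewrite /heis_mul /heis /=.
have RV : R h^-1%g *m R h = 1%:M by rewrite -repr_mxM ?inE // mulVg repr_mx1.
congr (_, _, _, _); last exact: mulVg.
- by rewrite mulNmx -mulmxA RV mulmx1 addNr.
- by rewrite addNr.
by rewrite mulNmx raddfN /= subrK subrr.
Qed.

HB.instance Definition _ := Finite_isGroup.Build (heisenberg R) heis_mulA heis_mul1 heis_mulV.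

End Heisenberg.

(** * Center, commutators and order of the extended Heisenberg group *)

Section HeisenbergTheory.

Variables (q k m : nat) (hT : finGroupType).
Variable R : mx_representation 'F_q [set: hT] m.
Local Notation H := [set: hT].
Local Notation E := (heisenberg k R).
Local Notation He := (@heis q k m hT R).

Lemma heisM a b z h a' b' z' h' : (He a b z h * He a' b' z' h')%g =
  He (a *m R h' + a') (b + R h *m b') (z + z' + \tr (a *m b')) (h * h')%g.
Proof. by []. Qed.

Lemma heis1 : (1 : E)%g = He 0 0 0 1%g. Proof. by []. Qed.

Definition heis_top (x : E) : hT := x.2.

Lemma heis_top_morphism : {in [set: E] &, {morph heis_top : x y / (x * y)%g}}.
Proof. by move=> [[[a b] z] h] [[[a' b'] z'] h']. Qed.
Canonical heis_top_hom := Morphism heis_top_morphism.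

Lemma heis_cX t n : (He 0 0 t 1 ^+ n)%g = He 0 0 (t *+ n) 1%g.
Proof.
elim: n => [|n IHn]; first by rewrite expg0 mulr0n.
by rewrite expgSr IHn heisM !mul0mx mulmx0 mxtrace0 !addr0 mulg1 mulrSr.
Qed.

Lemma commg_eq (gT : finGroupType) (x y c : gT) : (x * y = y * x * c -> [~ x, y] = c)%g.
Proof. by move=> xy; rewrite commgEl conjgE xy -mulgA !mulKg. Qed.

Hypothesis RZ : {in 'Z(H), forall h, R h = 1%:M}.

(** Commuting with [He a' b' 0 1] forces [\tr (a *m b') = \tr (a' *m b)] for all [a'] and [b'], so
    [a] and [b] vanish by nondegeneracy. Conversely [RZ] keeps the center of the top group
    central. *)
Lemma heis_center a b z h :
  (He a b z h \in 'Z([set: E])) = [&& a == 0, b == 0 & h \in 'Z(H)].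
Proof.
apply/idP/and3P=> [Zx | [/eqP-> /eqP-> Zh]]; last first.
  apply/centerP; split=> [|[[[a' b'] z'] h'] _]; first by rewrite inE.
  have /centerP[_ ch] := Zh.
  rewrite /commute !heisM !mul0mx !mulmx0 (RZ Zh) mul1mx mulmx1 !add0r !addr0.
  by rewrite !mxtrace0 !addr0 [z + _]addrC (ch h') ?inE.
have cx y : (He a b z h * y = y * He a b z h)%g.
  by case/centerP: Zx => _; apply; rewrite inE.
have Zh : h \in 'Z(H).
  apply/centerP; split=> [|h' _]; first by rewrite inE.
  by have /(congr1 heis_top) := cx (He 0 0 0 h').
have tr0 a' b' : \tr (a *m b') = \tr (a' *m b).
  have /(congr1 (fun x : E => x.1.2)) := cx (He a' b' 0 1%g).
  by rewrite !heisM /= addr0 add0r => /addrI.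
split=> //; apply/eqP.
  by apply: mxtrace_nondeg => b'; rewrite (tr0 0 b') mul0mx mxtrace0.
apply: trmx_inj; rewrite trmx0; apply: mxtrace_nondeg => a'.
by rewrite -[a']trmxK -trmx_mul mxtrace_tr -(tr0 _ 0) mulmx0 mxtrace0.
Qed.

Lemma heis_comm_fix a b z h a' b' : a' *m R h = a' -> R h *m b' = b' ->
  [~ He a b z h, He a' b' 0 1]%g = He 0 0 (\tr (a *m b') - \tr (a' *m b)) 1%g.
Proof.
move=> a'h hb'; apply: commg_eq; rewrite !heisM repr_mx1 a'h hb' !mul1mx !mulmx1 !mulmx0.
rewrite mxtrace0 !addr0 !mulg1 mul1g addrC [b + _]addrC add0r.
by congr (_, _, _, _); rewrite addrA addrAC addrK.
Qed.

Lemma heis_commg z h g : [~ He 0 0 z h, He 0 0 0 g]%g = He 0 0 0 [~ h, g]%g.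
Proof.
apply: commg_eq; rewrite !heisM !mul0mx !mulmx0 !mxtrace0 !addr0 !add0r.
by rewrite mul0mx -commgC.
Qed.

(** If no fixed point of [h] pairs nontrivially with [(a, b)], then duality puts [a] and [b] in the
    images of [R h - 1], and a conjugation removes them. *)
Lemma heis_conj_or_comm (x : E) : x \notin 'Z([set: E]) ->
  (exists y t, t != 0 /\ [~ x, y]%g = He 0 0 t 1%g) \/
  (heis_top x \notin 'Z(H) /\ exists y z, (x ^ y)%g = He 0 0 z (heis_top x)).
Proof.
case: x => [[[a b] z] h] /=; rewrite -[(a, b, z, h)]/(He a b z h) heis_center => nZx.
pose P (ab : 'M_(k, m) * 'M_(m, k)) := [&& ab.1 *m R h == ab.1, R h *m ab.2 == ab.2 &
   \tr (a *m ab.2) - \tr (ab.1 *m b) != 0].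
case: (pickP P) => [[a' b'] /and3P[/= /eqP a'h /eqP hb' t_neq0] | noP]; [left | right].
  by exists (He a' b' 0 1%g), (\tr (a *m b') - \tr (a' *m b)); rewrite heis_comm_fix.
have tr0 a' b' : a' *m R h = a' -> R h *m b' = b' -> \tr (a *m b') = \tr (a' *m b).
  move=> a'h hb'; have := noP (a', b'); rewrite /P /= a'h hb' !eqxx /=.
  by move/negbFE; rewrite subr_eq0 => /eqP.
have [|a0 def_a] := @trace_coker _ _ _ a (R h - 1%:M).
  move=> b'; rewrite mulmxBl mul1mx => /eqP; rewrite subr_eq0 => /eqP hb'.
  by rewrite (tr0 0 b') ?mul0mx ?mxtrace0.
have [|b0 def_b] := @trace_ker _ _ _ b (R h - 1%:M).
  move=> a'; rewrite mulmxBr mulmx1 => /eqP; rewrite subr_eq0 => /eqP a'h.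
  by rewrite -(tr0 a' 0) ?mulmx0 ?mxtrace0.
split.
  apply: contra nZx => Zh; rewrite Zh andbT def_a def_b (RZ Zh) subrr mulmx0 mul0mx.
  by rewrite !eqxx.
(* Found by solving [y * (x ^ y) = x * y] with [a = a0 *m (R h - 1)] and [b = (R h - 1) *m b0]; the
   corner records the trace picked up. *)
exists (He a0 (- b0) 0 1%g), (z + \tr (a *m - b0)).
apply: (mulgI (He a0 (- b0) 0 1%g)); rewrite conjgE !mulKVg !heisM.
rewrite def_a def_b repr_mx1 !mul1mx !mulmx0 mulmx1 mxtrace0 !addr0 mulg1 mul1g add0r.
congr (_, _, _, _); first by rewrite mulmxBr mulmx1 subrK.
by rewrite mulmxBl mul1mx mulmxN addrAC subrr add0r.
Qed.

Lemma card_heis : #|[set: E]| =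
  (#|{: 'M['F_q]_(k, m)}| * #|{: 'M['F_q]_(m, k)}| * #|{: 'F_q}| * #|hT|)%N.
Proof. by rewrite cardsT -!card_prod. Qed.

Lemma card_heis_center : #|'Z([set: E])| = (#|{: 'F_q}| * #|'Z(H)|)%N.
Proof.
have ->: 'Z([set: E]) = [set He 0 0 zh.1 zh.2 | zh in setX setT 'Z(H)].
  apply/setP=> [[[[a b] z] h]]; rewrite -[(a, b, z, h)]/(He a b z h) heis_center.
  apply/and3P/imsetP=> [[/eqP-> /eqP-> Zh] | [[z' h'] /setXP[_ Zh] [-> -> _ ->]]] //.
  by exists (z, h) => //; apply/setXP; rewrite inE.
rewrite card_in_imset ?cardsX ?cardsT // => [[z h] [z' h'] _ _ [-> ->]] //.
Qed.

Lemma index_heis_center : #|[set: E] : 'Z([set: E])|%g =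
  (#|{: 'M['F_q]_(k, m)}| * #|{: 'M['F_q]_(m, k)}| * #|H : 'Z(H)|%g)%N.
Proof.
have ZE_gt0 := cardG_gt0 'Z([set: E]).
apply/eqP; rewrite -(eqn_pmul2l ZE_gt0) Lagrange ?subsetT //.
rewrite card_heis card_heis_center; apply/eqP.
have := Lagrange (subsetT 'Z(H)); rewrite /= cardsT => <-; ring.
Qed.

Lemma heis_sol : prime q -> solvable H -> solvable [set: E].
Proof.
move=> q_pr solH.
rewrite (series_sol (ker_normal heis_top_hom)) andbC.
rewrite (isog_sol (first_isog heis_top_hom)) (solvableS (subsetT _)) //=.
apply: (pgroup_sol (p := q)); rewrite /pgroup.
have hT_gt0 : (0 < #|hT|)%N by rewrite -cardsT cardG_gt0.
have im_top : heis_top @* [set: E] = [set: hT].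
  apply/setP=> h; rewrite inE; apply/morphimP; exists (He 0 0 0 h) => //; exact: in_setT.
have: (#|'ker heis_top| * #|hT| == #|[set: E]|)%N.
  by rewrite -[#|hT|]cardsT -im_top card_morphim setIid Lagrange ?subsetT.
(* The kernel of the projection to the top group thus has order a power of [q]. *)
rewrite card_heis eqn_pmul2r // => /eqP->.
by rewrite !card_mx card_Fp // !pnatM !pnatX !pnat_id.
Qed.

(** As the commutator is central, [x^-1] commutes with [x ^ y], so their product [[~ x, y]] is a
    q'-element; it also has order dividing [q]. *)
Lemma p_elt_heis_comm (x y : E) t : prime q -> q^'.-elt x ->
  [~ x, y]%g = He 0 0 t 1%g -> t = 0.
Proof.
move=> q_pr q'x xyt.
have cx : commute x^-1 (x ^ y)%g.
  apply/commute_sym/commuteV; rewrite -[(x ^ y)%g](mulKVg x) -/(commg x y) xyt.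
  apply: commute_sym; apply: commuteM; first exact: commute_refl.
  case: (x) => [[[a b] z] h]; rewrite /commute -[(a, b, z, h)]/(He a b z h) !heisM.
  rewrite repr_mx1 !mul0mx !mulmx0 !mxtrace0 !mulmx1 !addr0 !add0r mul1g mulg1.
  by rewrite mul1mx addrC.
have q'c : q^'.-elt (He 0 0 t 1%g : E).
  by rewrite -xyt commgEl; apply: p_eltM; rewrite ?p_eltV ?p_eltJ.
have qc : q.-elt (He 0 0 t 1%g : E).
  rewrite /p_elt; apply: (@pnat_dvd _ q); last exact: pnat_id.
  rewrite order_dvdn heis_cX.
  by rewrite (mulrn_pchar (pchar_Fp q_pr)) heis1.
have: #[He 0 0 t 1%g : E]%g == 1%N by rewrite (pnat_1 qc q'c).
by rewrite order_eq1 heis1 => /eqP[].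
Qed.

End HeisenbergTheory.
Arguments heis_top_hom {q k m hT R}.

(** * Extending a twisted pair to the Heisenberg extension *)

Section HeisenbergRepr.

Variables (p q k m : nat) (F : closedFieldType) (hT : finGroupType).
Hypothesis q_pr : prime q.
Variable R : mx_representation 'F_q [set: hT] m.
Local Notation H := [set: hT].
Local Notation E := (heisenberg k R).
Local Notation He := (@heis q k m hT R).
Hypothesis RZ : {in 'Z(H), forall h, R h = 1%:M}.
Variables (n : nat) (rho : mx_representation F H n).
Hypothesis rhoP : twisted_pair p rho.

(** The two premises match the two cases of [heis_conj_or_comm]: a commutator in the corner, or one
    borrowed from the top group. *)
Lemma heis_twisted_comm N (sigma : mx_representation F [set: E] N) :
    (forall (x y : E) t, p^'.-elt x -> [~ x, y]%g = He 0 0 t 1%g -> t != 0 ->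
      sigma (He 0 0 t 1%g) != 1%:M) ->
    (forall h, rho h != 1%:M -> sigma (He 0 0 0 h) != 1%:M) ->
  forall x, p^'.-elt x -> x \notin 'Z([set: E]) ->
    exists2 g, [~ x, g]%g \in 'Z([set: E]) & sigma [~ x, g]%g != 1%:M.
Proof.
move=> sigma_t sigma_h x p'x nZx.
have [[y [t [t_neq0 xyt]]] | [nZh [y [z xy]]]] := heis_conj_or_comm RZ nZx.
  exists y; last by rewrite xyt; apply: sigma_t xyt t_neq0.
  by rewrite xyt heis_center // !eqxx group1.
have p'h : p^'.-elt (heis_top x) by rewrite (morph_p_elt heis_top_hom) ?inE.
have [_ _ _ /(_ _ p'h nZh)[g Zhg rhg]] := rhoP.
have Zc : He 0 0 0 [~ heis_top x, g]%g \in 'Z([set: E]).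
  by rewrite heis_center // !eqxx.
(* The commutator is computed for [x ^ y] and conjugated back by [y^-1], which fixes it because it
   is central. *)
suffices def_c : [~ x, (He 0 0 0 g) ^ y^-1]%g = He 0 0 0 [~ heis_top x, g]%g.
  by exists (He 0 0 0 g ^ y^-1)%g; rewrite def_c // sigma_h.
rewrite -[x in LHS](conjgK y) -conjRg xy heis_commg.
by case/centerP: Zc => _ cc; rewrite conjgE invgK cc ?inE // mulKVg.
Qed.

Lemma heis_lift_repr : mx_repr [set: E] (fun x : E => rho (heis_top x)).
Proof.
split=> [|x y _ _]; first exact: repr_mx1.
by rewrite (morphM heis_top_hom) ?inE // repr_mxM ?inE.
Qed.

(** The inflation is trivial on the corner, but by [p_elt_heis_comm] no p-regular element has a
    nontrivial commutator there when [p = q]. *)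
Lemma twisted_pair_inflate : p = q -> twisted_pair p (MxRepresentation heis_lift_repr).
Proof.
move=> p_q; have [solH irr_rho n_dvd _] := rhoP.
split; first exact: heis_sol.
- have /andP[n_gt0 full_rho] := irr_rho.
  rewrite /mx_absolutely_irreducible n_gt0 -sub1mx.
  apply: submx_trans (_ : (enveloping_algebra_mx rho <= _)%MS); first by rewrite sub1mx.
  apply/row_subP=> i; rewrite rowK.
  exact: (envelop_mx_id (MxRepresentation heis_lift_repr) (in_setT (He 0 0 0 (enum_val i)))).
- by rewrite index_heis_center // dvdn_mull.
apply: heis_twisted_comm => // x y t p'x xyt /eqP[].
have q'x : q^'.-elt x by move: p'x; rewrite p_q.
exact: p_elt_heis_comm xyt.
Qed.

Variable w : F.
Hypothesis prim_w : q.-primitive_root w.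

Definition add_char (t : 'F_q) : F := w ^+ t.

Lemma add_charD s t : add_char (s + t) = add_char s * add_char t.
Proof.
rewrite /add_char -exprD /= [X in (_ %% X)%N]Fp_cast //.
exact: prim_expr_mod.
Qed.

Lemma add_char_eq1 t : (add_char t == 1) = (t == 0).
Proof.
rewrite /add_char -(prim_order_dvd prim_w) -val_eqE /=.
have t_lt : (t < q)%N by rewrite -[X in (_ < X)%N](Fp_cast q_pr).
by rewrite /dvdn modn_small.
Qed.

Lemma add_char0 : add_char 0 = 1.
Proof. by apply/eqP; rewrite add_char_eq1. Qed.

Local Notation U := {: 'M['F_q]_(k, m)}.

(** Orthogonality of characters: for [d != 0], translating by some [b0] multiplies the sum by a
    value other than 1. *)
Lemma sum_add_char (d : 'M['F_q]_(k, m)) :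
  \sum_(b : 'M_(m, k)) add_char (\tr (d *m b)) = #|{: 'M['F_q]_(m, k)}|%:R *+ (d == 0).
Proof.
have [-> | d_neq0] := eqVneq d 0.
  under eq_bigr => b _ do rewrite mul0mx mxtrace0 add_char0.
  by rewrite sumr_const.
have [b0 db0] : exists b0 : 'M_(m, k), \tr (d *m b0) != 0.
  apply/existsP; apply: contraR d_neq0 => /existsPn tr0; apply/eqP/mxtrace_nondeg=> b.
  by apply/eqP/negPn.
set S := \sum_b _; have: S = add_char (\tr (d *m b0)) * S.
  rewrite [LHS](reindex_inj (addrI b0)) mulr_sumr; apply: eq_bigr => b _.
  by rewrite mulmxDr mxtraceD add_charD.
move/eqP; rewrite -subr_eq0 -{1}[S]mul1r -mulrBl mulf_eq0 subr_eq0 eq_sym.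
by rewrite add_char_eq1 (negPf db0) => /eqP.
Qed.

(* Functions on 'M_(k, m), with the top group acting by R and the rest of     *)
(* the Heisenberg group by translations and multiplications by characters.    *)
Definition schrodinger (x : E) : 'M[F]_#|U| :=
  let: (a, b, z, h) := x in
  \matrix_i (add_char (z + \tr (enum_val i *m b)) *:
               delta_mx 0 (enum_rank (enum_val i *m R h + a))).

Lemma schrodingerM x y : schrodinger (x * y)%g = schrodinger x *m schrodinger y.
Proof.
case: x y => [[[a b] z] h] [[[a' b'] z'] h'] /=.
apply/row_matrixP=> i; rewrite row_mul !rowK -scalemxAl -rowE rowK scalerA enum_rankK.
rewrite -add_charD; congr (add_char _ *: delta_mx 0 (enum_rank _)).
  rewrite mulmxDr mulmxDl !mxtraceD mulmxA; ring.
by rewrite repr_mxM ?inE // mulmxDl mulmxA addrA.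
Qed.

Lemma schrodinger_c t : schrodinger (He 0 0 t 1%g) = (add_char t)%:M.
Proof.
apply/row_matrixP=> i; rewrite rowK mulmx0 mxtrace0 !addr0 repr_mx1 mulmx1 enum_valK.
by rewrite -scalemx1 linearZ /= row1.
Qed.

Lemma tensmx1 (m1 m2 : nat) : (1%:M : 'M[F]_m1) *t (1%:M : 'M[F]_m2) = 1%:M.
Proof.
apply/matrixP=> i j; case: (mxtens_indexP i) => i1 i2; case: (mxtens_indexP j) => j1 j2.
rewrite tensmxE !mxE -natrM mulnb; congr (nat_of_bool _)%:R.
by rewrite (can_eq (@mxtens_indexK _ _)).
Qed.

Definition heis_tens (x : E) : 'M[F]_(#|U| * n) := schrodinger x *t rho (heis_top x).

Lemma heis_tens_repr : mx_repr [set: E] heis_tens.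
Proof.
split=> [|x y _ _]; last first.
  by rewrite /heis_tens tensmx_mul -schrodingerM -repr_mxM ?inE // (morphM heis_top_hom) ?inE.
by rewrite /heis_tens (schrodinger_c 0) repr_mx1 add_char0 tensmx1.
Qed.
Definition heis_tens_representation := MxRepresentation heis_tens_repr.

Local Notation Etens := (enveloping_algebra_mx heis_tens_representation).

Lemma tensmx_sumr m1 m2 I (r : seq I) (P : pred I) (A : 'M[F]_m1) (B : I -> 'M[F]_m2) :
  A *t (\sum_(i <- r | P i) B i) = \sum_(i <- r | P i) (A *t B i).
Proof.
by apply/matrixP=> i j; rewrite !mxE !summxE mulr_sumr; apply: eq_bigr => l _; rewrite mxE.
Qed.

Lemma tensmx_suml m1 m2 I (r : seq I) (P : pred I) (A : I -> 'M[F]_m1) (B : 'M[F]_m2) :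
  (\sum_(i <- r | P i) A i) *t B = \sum_(i <- r | P i) (A i *t B).
Proof.
by apply/matrixP=> i j; rewrite !mxE !summxE mulr_suml; apply: eq_bigr => l _; rewrite mxE.
Qed.

Lemma tensmxZr m1 m2 c (A : 'M[F]_m1) (B : 'M[F]_m2) : A *t (c *: B) = c *: (A *t B).
Proof. by apply/matrixP=> i j; rewrite !mxE mulrCA. Qed.

Lemma tensmxZl m1 m2 c (A : 'M[F]_m1) (B : 'M[F]_m2) : (c *: A) *t B = c *: (A *t B).
Proof. by apply/matrixP=> i j; rewrite !mxE mulrA. Qed.

(* Fourier inversion on the dual 'M_(m, k): averaging the action of a coset   *)
(* against a character isolates one matrix unit.                              *)
Lemma schrodinger_delta (i j : 'I_#|U|) h :
  \sum_(b : 'M_(m, k)) add_char (- \tr (enum_val i *m b)) *: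
    schrodinger (He (enum_val j - enum_val i *m R h) b 0 h)
  = #|{: 'M['F_q]_(m, k)}|%:R *: delta_mx i j.
Proof.
apply/row_matrixP=> l; rewrite linear_sum linearZ /=.
have [-> | l_i] := eqVneq l i.
  rewrite (eq_bigr (fun=> delta_mx 0 j)) => [|b _].
    rewrite sumr_const scaler_nat; congr (_ *+ _); apply/rowP=> s.
    by rewrite !mxE !eqxx.
  rewrite linearZ /= rowK scalerA -add_charD add0r addNr add_char0 scale1r.
  by rewrite addrC subrK enum_valK.
rewrite (eq_bigr (fun b => add_char (\tr ((enum_val l - enum_val i) *m b)) *:
     delta_mx 0 (enum_rank (enum_val l *m R h + (enum_val j - enum_val i *m R h))))) => [|b _].
  rewrite -scaler_suml sum_add_char subr_eq0 (inj_eq enum_val_inj) (negPf l_i) scale0r.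
  by apply/rowP=> s; rewrite !mxE (negPf l_i) mulr0.
rewrite linearZ /= rowK scalerA -add_charD add0r.
by rewrite mulmxBl raddfB /= addrC.
Qed.

(** The enveloping algebra contains every matrix unit tensored with every [rho h], by
    [schrodinger_delta]. The [rho h] span the full matrix algebra, so it contains every block
    matrix. *)
Lemma heis_tens_abs_irr : mx_absolutely_irreducible heis_tens_representation.
Proof.
have [_ irr_rho _ _] := rhoP; have /mx_abs_irrP[n_gt0 [c_ rho_c]] := irr_rho.
have U_gt0 : (0 < #|U|)%N by apply/card_gt0P; exists 0.
rewrite /mx_absolutely_irreducible muln_gt0 U_gt0 n_gt0 /= -sub1mx.
have delta_h i j h : (delta_mx i j *t rho h \in Etens)%MS.
  (* A power of [q], invertible because [F] has a primitive [q]-th root of unity. *)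
  have V_neq0 : #|{: 'M['F_q]_(m, k)}|%:R != 0 :> F.
    rewrite card_mx card_Fp // natrX expf_neq0 //.
    exact: prim_root_natf_neq0 prim_w.
  rewrite -[delta_mx i j](scalerK V_neq0) -(schrodinger_delta i j h) tensmxZl tensmx_suml.
  rewrite linearZ scalemx_sub // linear_sum summx_sub // => b _.
  rewrite tensmxZl linearZ scalemx_sub //.
  exact: (envelop_mx_id heis_tens_representation (in_setT (He _ b 0 h))).
have delta_B i j B : (delta_mx i j *t B \in Etens)%MS.
  rewrite [B]rho_c tensmx_sumr linear_sum summx_sub // => h _.
  by rewrite tensmxZr linearZ scalemx_sub // delta_h.
apply/row_subP=> l; rewrite -[row l _]vec_mxK; set A := vec_mx _.
have ->: A = \sum_i \sum_j delta_mx i j *t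
     (\matrix_(s, t) A (mxtens_index (i, s)) (mxtens_index (j, t))).
  apply/matrixP=> s t; case: (mxtens_indexP s) => i s'; case: (mxtens_indexP t) => j t'.
  rewrite summxE (bigD1 i) //= summxE (bigD1 j) //= tensmxE !mxE !eqxx mul1r.
  rewrite !big1 ?addr0 // => i' i'_i.
    rewrite summxE big1 // => j' _; rewrite tensmxE !mxE eq_sym (negPf i'_i) mul0r //.
  by rewrite tensmxE !mxE eqxx eq_sym (negPf i'_i) mul0r.
rewrite linear_sum summx_sub // => i _; rewrite linear_sum summx_sub // => j _.
exact: delta_B.
Qed.

Lemma twisted_pair_schrodinger : twisted_pair p heis_tens_representation.
Proof.
have [solH irr_rho n_dvd _] := rhoP.
split; first exact: heis_sol.
- exact: heis_tens_abs_irr.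
- by rewrite index_heis_center // dvdn_mul // dvdn_mulr.
have U_gt0 : (0 < #|U|)%N by apply/card_gt0P; exists 0.
have [n_gt0 _] := andP irr_rho.
apply: heis_twisted_comm => [x y t _ _ | h].
  apply: contraNneq; rewrite /= /heis_tens schrodinger_c repr_mx1 => /matrixP.
  pose ij := mxtens_index (Ordinal U_gt0, Ordinal n_gt0).
  move/(_ ij ij); rewrite tensmxE !mxE !eqxx mulr1 => /eqP.
  by rewrite add_char_eq1.
apply: contra_neq; rewrite /= /heis_tens => /matrixP rho1; apply/matrixP=> s t.
(* The zero matrix is fixed by every [R h], so the diagonal block at [o] of the image of
   [He 0 0 0 h] is [rho h]. *)
pose o : 'I_#|U| := enum_rank 0.
have := rho1 (mxtens_index (o, s)) (mxtens_index (o, t)).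
rewrite tensmxE !mxE enum_rankK !mul0mx mxtrace0 !addr0 add_char0 !eqxx !mul1r => ->.
by rewrite (can_eq (@mxtens_indexK _ _)) xpair_eqE eqxx.
Qed.

End HeisenbergRepr.

(** * The embedding of Kaloujnine and Krasner *)

Lemma mulmx_regularE (K : fieldType) (gT : finGroupType) (G : {group gT}) k
    (A : 'M[K]_(k, #|G|)) x i j : x \in G ->
  (A *m regular_mx K G x) j i = A j (gring_index G (enum_val i * x^-1)%g).
Proof.
move=> Gx; set l := gring_index _ _.
have Gi : enum_val i \in G by apply: enum_valP.
have def_l : (enum_val l = enum_val i * x^-1)%g by rewrite gring_indexK ?groupM ?groupV.
rewrite mxE (bigD1 l) //= big1 => [|l' l'_l].
  by rewrite !mxE def_l mulgKV gring_valK !eqxx mulr1 addr0.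
rewrite !mxE /=; case: eqP => [def_i | _]; last by rewrite mulr0.
case/eqP: l'_l; rewrite -[l']gring_valK -[l]gring_valK def_l def_i gring_indexK ?mulgK //.
by rewrite groupM ?enum_valP.
Qed.

(* With s t in G lifting the part in pi(G) of t : Q, the matrix a x lists the *)
(* coordinates of the elements s (t * (pi x)^-1) * x * (s t)^-1 of N, t in Q. *)
Lemma kaloujnine_krasner q (gT rT : finGroupType) (G N : {group gT}) (Q : {group rT})
    (pi : {morphism G >-> rT}) :
    pi @* G \subset Q -> 'ker pi = N -> q.-abelem%g N -> (N :!=: 1)%g ->
  exists k (a : gT -> 'M['F_q]_(k, #|Q|)),
    {in G &, forall x y, a (x * y)%g = a x *m regular_mx 'F_q Q (pi y) + a y} /\
    {in N, forall x, a x = 0 -> x = 1%g}.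
Proof.
move=> sGQ kerN abelN ntN; pose ab := abelem_rV abelN ntN.
pose T := pi @* G; pose r t := repr (t *: T)%g.
have sNG : N \subset G by rewrite -kerN subsetIl.
have r_lcoset t : (t^-1 * r t)%g \in T.
  by rewrite -mem_lcoset; apply: mem_repr (lcoset_refl _ _).
have rM t u : u \in T -> r (t * u)%g = r t.
  move=> Tu; rewrite /r; congr (repr _); apply/lcoset_eqP.
  by rewrite mem_lcoset mulKg.
pose s t := repr [set g in G | pi g == (r t)^-1 * t]%g.
have sP t : s t \in G /\ pi (s t) = ((r t)^-1 * t)%g.
  have: ((r t)^-1 * t)%g \in T by rewrite -groupV invMg invgK.
  case/morphimP=> g _ Gg def_g.
  have: s t \in [set g in G | pi g == (r t)^-1 * t]%g.
    by apply: (mem_repr g); rewrite inE Gg def_g eqxx.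
  by rewrite inE => /andP[? /eqP].
pose c g t := (s (t * (pi g)^-1) * g * (s t)^-1)%g.
have Npi g : g \in G -> pi g \in T by move=> Gg; apply: mem_morphim.
have cN g t : g \in G -> c g t \in N.
  move=> Gg; have [Gs pis] := sP t; have [Gs' pis'] := sP (t * (pi g)^-1)%g.
  rewrite -kerN; apply/kerP; rewrite ?groupM ?groupV //.
  rewrite !morphM ?groupM ?groupV // morphV // pis pis' rM ?groupV ?Npi //.
  by rewrite invMg invgK -!mulgA mulKg mulKVg mulVg.
pose a g : 'M['F_q]_(_, #|Q|) := \matrix_(j, i) ab (c g (enum_val i)) 0 j.
exists _, a; split=> [g g' Gg Gg' | g Ng ag0].
  apply/matrixP=> j i; have Qg' : pi g' \in Q by rewrite (subsetP sGQ) ?Npi.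
  rewrite [RHS]mxE mulmx_regularE // !mxE.
  rewrite gring_indexK ?groupM ?groupV ?enum_valP //.
  have ->: c (g * g')%g (enum_val i) = (c g (enum_val i * (pi g')^-1) * c g' (enum_val i))%g.
    by rewrite /c !mulgA mulgKV morphM // invMg !mulgA.
  by rewrite [ab _]abelem_rV_M ?cN // mxE.
have Gg : g \in G := subsetP sNG g Ng.
have pig : pi g = 1%g by apply/kerP; rewrite ?kerN.
(* For [g] in the kernel, the coordinate at 1 is the conjugate [s 1 * g * (s 1)^-1], so its
   vanishing gives [g = 1]. *)
have cg1 : c g 1%g = 1%g.
  apply: (@abelem_rV_inj _ _ _ abelN ntN); rewrite ?group1 ?cN //; apply/rowP=> j.
  have /matrixP/(_ j (gring_index Q 1%g)) := ag0.
  by rewrite abelem_rV_1 !mxE gring_indexK.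
apply: (mulgI (s 1%g)); apply: (mulIg (s 1%g)^-1%g).
by rewrite mulg1 mulgV -[RHS]cg1 /c pig invg1 mulg1.
Qed.

(** * The induction on the order of the solvable group *)

Definition twisted_embedding (p : nat) (F : closedFieldType) (gT : finGroupType)
    (G : {group gT}) :=
  exists (hT : finGroupType) n (rho : mx_representation F [set: hT] n),
    twisted_pair p rho /\ exists f : {morphism G >-> coset_of 'Z([set: hT])}, ('injm f)%g.

Lemma twisted_embedding1 (p : nat) (F : closedFieldType) (gT : finGroupType)
    (G : {group gT}) :
  G :=: 1%g -> twisted_embedding p F G.
Proof.
move=> G1; pose hT : finGroupType := 'I_1.
have cHH : abelian [set: hT] by apply/centsP=> x _ y _; rewrite /commute !ord1.
have one_repr : mx_repr [set: hT] (fun=> 1%:M : 'M[F]_1).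
  by split=> // x y _ _; rewrite mulmx1.
exists hT, 1%N, (MxRepresentation one_repr); split.
  split; first exact: abelian_sol.
  - exact: linear_mx_abs_irr.
  - exact: dvd1n.
  by move=> x _; rewrite (center_idP cHH) inE.
by exists (triv_morph _ G); rewrite ker_trivm G1.
Qed.

Lemma coset_centerM (gT : finGroupType) (x y : gT) :
  coset 'Z([set: gT]) (x * y) = (coset 'Z([set: gT]) x * coset 'Z([set: gT]) y)%g.
Proof. by rewrite morphM ?(subsetP (normal_norm (center_normal [set: gT]%G))) ?inE. Qed.

Section Step.

Variables (p q : nat) (F : closedFieldType) (gT : finGroupType) (G N : {group gT}).
Hypothesis q_pr : prime q.
Hypothesis prim_roots : q != p -> exists w : F, q.-primitive_root w.
Hypotheses (nNG : (N <| G)%g) (abelN : q.-abelem%g N) (ntN : (N :!=: 1)%g).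

Lemma twisted_embedding_ext : twisted_embedding p F (G / N)%G -> twisted_embedding p F G.
Proof.
case=> hT [n [rho [rhoP [f inj_f]]]]; set Z := 'Z([set: hT]) in f inj_f.
have sGN : G \subset 'N(N)%g := normal_norm nNG.
pose piN x := f (coset N x).
have pi_M : {in G &, {morph piN : x y / (x * y)%g}}.
  move=> x y Gx Gy; rewrite /piN morphM ?(subsetP sGN) //.
  by rewrite morphM ?mem_quotient.
pose pi := Morphism pi_M.
have ker_pi : 'ker pi = N.
  apply/setP=> x; have [Gx | nGx] := boolP (x \in G); last first.
    by rewrite !inE (negPf nGx); apply/esym/(contraNF _ nGx)/(subsetP (normal_sub nNG)).
  apply/kerP/idP=> // [/= pix1 | Nx]; last by rewrite /= /piN coset_id ?morph1.
  apply: coset_idr; rewrite ?(subsetP sGN) //.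
  by apply: (injmP inj_f); rewrite ?group1 ?mem_quotient // morph1.
pose Q := [set: coset_of Z]%G.
have [k [a [aM a_inj]]] := kaloujnine_krasner (Q := Q) (subsetT _) ker_pi abelN ntN.
have R_repr : mx_repr [set: hT] (fun h => regular_mx 'F_q Q (coset Z h)).
  have [R1 RM] := regular_mx_repr 'F_q Q.
  split=> [|x y _ _]; first by rewrite morph1.
  by rewrite coset_centerM RM ?inE.
pose R := MxRepresentation R_repr; pose He := @heis q k _ hT R.
have RZ : {in Z, forall h, R h = 1%:M}.
  by move=> h Zh; rewrite /= coset_id // (regular_mx_repr 'F_q Q).1.
pose Z' := 'Z([set: heisenberg k R]).
(* The second coordinate stays 0, so no trace term arises. The section [repr] is multiplicative only
   up to [Z], which lies in the new center. *)
pose f' x : coset_of Z' := coset Z' (He (a x) 0 0 (repr (pi x))).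
have f'M : {in G &, {morph f' : x y / (x * y)%g}}.
  move=> x y Gx Gy; rewrite /f' -coset_centerM heisM /= coset_reprK -aM // !mulmx0 mxtrace0 !addr0.
  set hxy := repr (pi (x * y)%g).
  pose z := (hxy^-1 * (repr (pi x) * repr (pi y)))%g.
  have Zz : z \in Z.
    apply: coset_idr; first by rewrite (subsetP (normal_norm (center_normal [set: hT]%G))) ?inE.
    apply: (mulgI (coset Z hxy)).
    by rewrite mulg1 -coset_centerM mulKVg coset_centerM !coset_reprK morphM.
  rewrite [X in _ = coset _ X](_ : _ = He (a (x * y)%g) 0 0 hxy * He 0 0 0 z)%g; last first.
    by rewrite heisM (RZ z Zz) mulmx1 !mulmx0 mxtrace0 !addr0 mulKVg.
  by rewrite coset_centerM [coset _ (He 0 0 0 z)]coset_id ?mulg1 // heis_center // !eqxx.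
have inj_f' : ('injm (Morphism f'M))%g.
  apply/subsetP=> x /[dup] /(subsetP (subsetIl _ _)) /= Gx /kerP-/(_ Gx) /= f'x1.
  have: He (a x) 0 0 (repr (pi x)) \in Z'.
    apply: coset_idr f'x1.
    by rewrite (subsetP (normal_norm (center_normal [set: heisenberg k R]%G))) ?inE.
  rewrite /Z' heis_center // => /and3P[/eqP ax0 _ Zx].
  rewrite inE; apply/eqP/a_inj => //; rewrite -ker_pi; apply/kerP=> //.
  by rewrite -[LHS]coset_reprK coset_id.
have [q_p | q_p] := eqVneq q p.
  exists (heisenberg k R), n, (MxRepresentation (heis_lift_repr k R rho)).
  split; last by exists (Morphism f'M).
  exact: twisted_pair_inflate.
have [w prim_w] := prim_roots q_p.
exists (heisenberg k R), _, (heis_tens_representation k q_pr R rho prim_w).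
split; last by exists (Morphism f'M).
exact: twisted_pair_schrodinger.
Qed.

End Step.

Lemma solvable_twisted_embedding (p : nat) (F : closedFieldType) (gT : finGroupType)
    (G : {group gT}) :
    (forall q, prime q -> q != p -> exists w : F, q.-primitive_root w) ->
  solvable G -> twisted_embedding p F G.
Proof.
move=> prim_roots; have [c] := ubnP #|G|; elim: c => // c IHc in gT G *.
rewrite ltnS => leGc solG; have [G1 | ntG] := eqVneq (G :> {set gT}) 1%g.
  exact: twisted_embedding1.
have [N [sNG nNG ntN /is_abelemP[q q_pr abelN]]] :=
  solvable_norm_abelem solG (normal_refl G) ntG.
apply: (twisted_embedding_ext q_pr (prim_roots q q_pr) nNG abelN ntN).
apply: IHc; last exact: quotient_sol.
by apply: leq_trans leGc; rewrite ltn_quotient.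
Qed.

Local Close Scope ring_scope.

Theorem theorem2 (p : nat) (p_prime : prime p)
    (F : closedFieldType) (red : algC -> F) (red_p : is_reduction p red)
    (gT : finGroupType) (G : {group gT}) (solG : solvable G) :
  exists (hT : finGroupType) (H : {group hT}),
    p_central_type p red H /\
    exists2 K : {group coset_of 'Z(H)}, K \subset H / 'Z(H) & G \isog K.
Proof.
have [|hT [n [rho [rhoP [f inj_f]]]]] := @solvable_twisted_embedding p F gT G _ solG.
  (* For [q != p], a complex primitive [q]-th root of unity stays primitive after reduction. *)
  move=> q q_pr q_p; have [z prz] := C_prim_root_exists (prime_gt0 q_pr).
  exists (red z); apply: (reduction_prim_root red_p) prz => //.
  by rewrite pnatE // !inE.
exists hT, [set: hT]%G; split; first exact: twisted_pair_central_type rhoP.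
exists (f @* G)%G; last by apply/isogP; exists f.
apply/subsetP=> _ /morphimP[x _ _ ->]; rewrite -(coset_reprK (f x)).
by rewrite mem_quotient ?inE.
Qed.
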